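(* Let $f(x)=g(a_2x^2+a_1x)+a_0\in\mathbb Z[x]$ with $g\ge1$ an integer and $\gcd(a_1,a_2)=1$. Then for every positive integer $l$, \[l!_{f(\mathbb Z)}=g^l\prod_{p\mid a_2}p^{k(p,l)}\prod_{p\nmid a_2}p^{k(p,2l)}\cdot 2^{-\delta_{\{2\mid a_1,\ 2\nmid a_2\}}},\] where the products run over primes $p$, $k(p,l)=\sum_{k=1}^\infty\left\lfloor \frac{l}{p^k}\right\rfloor$, and $\delta_{\{2\mid a_1,\ 2\nmid a_2\}}$ equals $1$ if $a_1$ is even and $a_2$ is odd, and $0$ otherwise.
   Context: Bhargava factorial over $\mathbb Z$: let $S\subset\mathbb Z$ be infinite and $p$ a prime. A $p$-ordering of $S$ is a sequence $(a_n)_{n\ge0}$ in $S$ where $a_0\in S$ is arbitrary and, for $n\ge1$, $a_n\in S$ is chosen so that $v_p\bigl(\prod_{k=0}^{n-1}(a_n-a_k)\bigr)=\min_{x\in S}v_p\bigl(\prod_{k=0}^{n-1}(x-a_k)\bigr)$, with $v_p$ the $p$-adic valuation. Set $v_p(n;S)=v_p\bigl(\prod_{k=0}^{n-1}(a_n-a_k)\bigr)$; this is independent of the chosen $p$-ordering. The Bhargava factorial is the positive integer $l!_S=\prod_{p\text{ prime}}p^{v_p(l;S)}$. *)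

(* Defs.v *)
From HB Require Import structures.
From mathcomp Require Export all_boot all_order all_algebra.
From mathcomp Require Export boolp classical_sets fsbigop constructive_ereal.

Set Implicit Arguments.
Unset Strict Implicit.
Unset Printing Implicit Defensive.

Import Order.TTheory GRing.Theory Num.Theory.

Local Open Scope classical_set_scope.
Local Open Scope ring_scope.

(* logn p 0 = 0, so the value v_p(0) = +oo has to be added by hand. *)
Definition padic_val (p : nat) (z : int) : \bar int :=
  if z == 0 then +oo%E else ((logn p `|z|%N)%:Z)%:E.

Definition p_ordering (p : nat) (S : set int) (a : nat -> int) : Prop :=
  (forall n, S (a n)) /\
  (forall n, (0 < n)%N -> forall x, S x ->
     (padic_val p (\prod_(k < n) (a n - a k))
        <= padic_val p (\prod_(k < n) (x - a k)))%E).

(* The invariant v_p(n; S), read off some p-ordering of S.  For S infinite a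
   p-ordering exists, the valuation below is finite, and by Bhargava's theorem
   it does not depend on the p-ordering; the default 0 is then never used. *)
Definition bhargava_val (p : nat) (n : nat) (S : set int) : nat :=
  xget 0%N [set v : nat | exists2 a : nat -> int, p_ordering p S a &
              padic_val p (\prod_(k < n) (a n - a k)) = (v%:Z)%:E].

(* For S infinite only finitely many primes contribute a factor other than 1,
   so the finitely-supported product is the product over all primes. *)
Definition bhargava_fact (l : nat) (S : set int) : nat :=
  \big[muln/1%N]_(p \in [set p : nat | prime p]) (p ^ bhargava_val p l S)%N.

(* The sum over k >= 1 has finite support as soon as p >= 2. *)
Definition legendre_sum (p l : nat) : nat :=
  \big[addn/0%N]_(k \in [set k : nat | (1 <= k)%N]) (l %/ p ^ k)%N.

(* Main.v *)
Require Import Defs.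
From mathcomp Require Import functions ring zify.

Set Implicit Arguments.
Unset Strict Implicit.
Unset Printing Implicit Defensive.

Import Order.TTheory GRing.Theory Num.Theory.
Local Open Scope classical_set_scope.
Local Open Scope ring_scope.

(* Expanding a monic polynomial of degree n in the Newton basis of a p-ordering
   a shows that, if p^e divides its values on S, then p^e divides
   prod_(k < n) (a_n - a_k).  Applied to the Newton polynomials of another
   sequence which is a p-ordering up to index n, this determines v_p(n; S), so
   one such finite sequence suffices for each p.
   If p | a2, the factor a2(x + y) + a1 of f(x) - f(y) is prime to p and
   f(0), f(1), ... works, as for Z.  If not, choose an integer c congruent to
   a1/a2 modulo a high power of p: up to a unit f(x) - f(y) becomes
   g(x - y)(x + y + c), and consecutive integers starting next to the centre of
   symmetry -c/2 turn the products into 2n consecutive integers, whence (2n)!.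
   The parity of c, free for p odd, is forced for p = 2; when a1 is even the
   centre is itself an integer and (2n)! is replaced by (2n)!/2. *)

(** * Newton expansion of integer polynomials *)

Definition newton_basis (b : nat -> int) (k : nat) : {poly int} :=
  \prod_(i < k) ('X - (b i)%:P).

Lemma horner_newton_basis b k x :
  (newton_basis b k).[x] = \prod_(i < k) (x - b i).
Proof. by rewrite horner_prod; apply: eq_bigr => i _; rewrite hornerXsubC. Qed.

Lemma size_newton_basis b k : size (newton_basis b k) = k.+1.
Proof.
by rewrite size_prod_XsubC /index_enum -enumT size_enum_ord.
Qed.

Lemma newton_basis_monic b k : newton_basis b k \is monic.
Proof. exact: monic_prod_XsubC. Qed.

(** The basis polynomials are monic, so leading terms are removed one degree at a time without
    division and the coefficients stay integral. *)
Lemma newton_expansion (b : nat -> int) n (P : {poly int}) :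
  (size P <= n.+1)%N ->
  {c : nat -> int | P = \sum_(k < n.+1) c k *: newton_basis b k & c n = P`_n}.
Proof.
elim: n P => [|n IHn] P sP.
  exists (fun=> P`_0) => //.
  by rewrite big_ord1 /newton_basis big_ord0 {1}(size1_polyC sP) alg_polyC.
have sQ : (size (P - P`_n.+1 *: newton_basis b n.+1)%R <= n.+1)%N.
  apply/leq_sizeP => j; rewrite leq_eqVlt => /predU1P[<-|ltnj].
    rewrite coefB coefZ.
    have := newton_basis_monic b n.+1.
    rewrite monicE lead_coefE size_newton_basis /= => /eqP ->.
    by rewrite mulr1 subrr.
  have Pj : P`_j = 0 by rewrite nth_default // (leq_trans sP).
  by rewrite coefB coefZ Pj [X in _ * X]nth_default ?mulr0 ?subr0 // size_newton_basis.
have [c defQ _] := IHn _ sQ.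
exists (fun k => if k == n.+1 then P`_n.+1 else c k); last by rewrite eqxx.
rewrite big_ord_recr /= eqxx -[LHS](subrK (P`_n.+1 *: newton_basis b n.+1)).
congr (_ + _); rewrite {1}defQ; apply: eq_bigr => k _.
by rewrite ltn_eqF.
Qed.

(* The hypothesis [b_opt] is the minimality of a p-ordering, in the only form
   the argument uses; Newton's coefficients are then controlled bottom up. *)
Lemma dvdz_newton_top (d : int) n (b : nat -> int) (P : {poly int}) :
    P \is monic -> size P = n.+1 ->
    (forall k, (k <= n)%N -> (d %| P.[b k])%Z) ->
    (forall (c : int) j k, (j <= k <= n)%N -> (d %| c * \prod_(i < j) (b j - b i))%Z ->
       (d %| c * \prod_(i < j) (b k - b i))%Z) ->
  (d %| \prod_(i < n) (b n - b i))%Z.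
Proof.
move=> Pmon sP dP b_opt.
have [c defP cn] : {c : nat -> int |
    P = \sum_(k < n.+1) c k *: newton_basis b k & c n = P`_n}.
  by apply: newton_expansion; rewrite sP.
(* Evaluation at [b k] kills the terms of index above [k]; those below are divisible by induction
   and [b_opt], which isolates the [k]-th term. *)
have dc k : (k <= n)%N -> (d %| c k * \prod_(i < k) (b k - b i))%Z.
  elim/ltn_ind: k => k IHk lekn.
  have := dP k lekn; rewrite defP horner_sum.
  rewrite (bigD1 (inord k)) //= inordK ?ltnS // hornerZ horner_newton_basis.
  rewrite rpredDr //; apply: rpred_sum => j /= jk.
  rewrite hornerZ horner_newton_basis; case: (ltngtP j k) => ltjk.
  - apply: b_opt; first by rewrite (ltnW ltjk).
    exact: (IHk _ ltjk (leq_trans (ltnW ltjk) lekn)).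
  - by rewrite (bigD1 (Ordinal ltjk)) //= subrr mul0r mulr0 dvdz0.
  - by case/negP: jk; apply/eqP; apply: val_inj; rewrite /= inordK ?ltnS.
have := dc n (leqnn n); rewrite cn.
by move: Pmon; rewrite monicE lead_coefE sP /= => /eqP ->; rewrite mul1r.
Qed.

(** * Valuations, p-orderings and their invariance *)

Lemma dvdz_pfactor p e (z : int) : prime p -> z != 0 ->
  ((p ^ e)%N%:Z %| z)%Z = (e <= logn p `|z|)%N.
Proof. by move=> pr_p z0; rewrite dvdzE absz_nat pfactor_dvdn // absz_gt0. Qed.

Lemma padic_val_dvd p e (z : int) : prime p ->
  ((p ^ e)%N%:Z %| z)%Z = ((e%:Z)%:E <= padic_val p z)%E.
Proof.
move=> pr_p; rewrite /padic_val; have [->|z0] := eqVneq z 0.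
  by rewrite dvdz0 leey.
by rewrite dvdz_pfactor // lee_fin lez_nat.
Qed.

Lemma dvdz_pfactor_mul_le p e (c w z : int) : prime p ->
    (padic_val p w <= padic_val p z)%E ->
  ((p ^ e)%N%:Z %| c * w)%Z -> ((p ^ e)%N%:Z %| c * z)%Z.
Proof.
move=> pr_p; rewrite /padic_val.
have [->|z0] := eqVneq z 0; first by rewrite mulr0 dvdz0.
have [->|w0] := eqVneq w 0; first by rewrite leye_eq.
have [->|c0] := eqVneq c 0; first by rewrite !mul0r.
rewrite lee_fin lez_nat => le_wz; rewrite !dvdz_pfactor ?mulf_neq0 // !abszM.
rewrite !lognM ?absz_gt0 // => /leq_trans; apply; exact: leq_add.
Qed.

(** A truncated notion is used because a congruence modulo a fixed [p ^ M] controls only finitely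
    many indices. *)
Definition p_ordering_upto (p n : nat) (S : set int) (a : nat -> int) : Prop :=
  (forall k, (k <= n)%N -> S (a k)) /\
  (forall k, (k <= n)%N -> forall x, S x ->
     (padic_val p (\prod_(i < k) (a k - a i))
        <= padic_val p (\prod_(i < k) (x - a i)))%E).

Lemma p_ordering_uptoW p n S a : p_ordering p S a -> p_ordering_upto p n S a.
Proof.
case=> aS aP; split=> [k _|k _ x Sx]; first exact: aS.
by case: k => [|k]; [rewrite !big_ord0 | apply: aP].
Qed.

Lemma p_ordering_upto_dvd p n S a e (P : {poly int}) : prime p ->
    p_ordering_upto p n S a -> P \is monic -> size P = n.+1 ->
    (forall x, S x -> ((p ^ e)%N%:Z %| P.[x])%Z) ->
  ((p ^ e)%N%:Z %| \prod_(i < n) (a n - a i))%Z.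
Proof.
move=> pr_p [aS aP] Pmon sP dP; apply: (dvdz_newton_top Pmon sP).
  by move=> k lekn; apply/dP/aS.
move=> c j k /andP[lejk lekn]; apply: dvdz_pfactor_mul_le => //.
by apply: aP; [apply: leq_trans lekn | apply: aS].
Qed.

(** By minimality, a power of [p] dividing the Newton polynomial of [a] at [a n] divides it on all
    of [S], hence divides the product for [b]. Exchanging [a] and [b] gives invariance. *)
Lemma p_ordering_upto_le p n S a b : prime p ->
    p_ordering_upto p n S a -> p_ordering_upto p n S b ->
  (padic_val p (\prod_(i < n) (a n - a i))
     <= padic_val p (\prod_(i < n) (b n - b i)))%E.
Proof.
move=> pr_p aP bP.
have dvd_ab e : ((p ^ e)%N%:Z %| \prod_(i < n) (a n - a i))%Z ->
    ((p ^ e)%N%:Z %| \prod_(i < n) (b n - b i))%Z.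
  move=> dva; apply: (p_ordering_upto_dvd pr_p bP (newton_basis_monic a n)).
    exact: size_newton_basis.
  move=> x Sx; rewrite horner_newton_basis padic_val_dvd //.
  by rewrite (le_trans _ (aP.2 n _ x Sx)) -?padic_val_dvd.
set w := \prod_(i < n) (b n - b i) in dvd_ab *.
have [w0|w0] := eqVneq w 0; first by rewrite w0 /padic_val eqxx leey.
rewrite leNgt; apply/negP => lt_ba.
(* One power more than [w] allows; this also covers a vanishing product for [a], of valuation
   [+oo]. *)
have /dvd_ab : ((p ^ (logn p `|w|).+1)%N%:Z %| \prod_(i < n) (a n - a i))%Z.
  rewrite padic_val_dvd //; move: lt_ba; rewrite /padic_val (negbTE w0).
  by case: eqP => [_ _|_]; rewrite ?leey // lte_fin lee_fin ltz_nat lez_nat.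
by rewrite dvdz_pfactor // ltnn.
Qed.

Lemma padic_val_min p (T : Type) (S : set T) (F : T -> int) : S !=set0 ->
  exists2 a, S a & forall x, S x -> (padic_val p (F a) <= padic_val p (F x))%E.
Proof.
move=> [s Ss].
have [[x0 [Sx0 Fx0]]|noF] := pselect (exists x, S x /\ F x != 0); last first.
  exists s => // x Sx; have -> : F x = 0.
    by apply: contrapT => /eqP Fx; apply: noF; exists x.
  by rewrite {2}/padic_val eqxx leey.
pose Q v := `[< exists x, [/\ S x, F x != 0 & logn p `|F x| = v] >].
have exQ : exists v, Q v by exists (logn p `|F x0|); apply/asboolP; exists x0.
case: (ex_minnP exQ) => v /asboolP[a [Sa Fa <-]] min_a.
exists a => // x Sx; rewrite /padic_val (negbTE Fa); case: eqVneq => [_|Fx].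
  exact: leey.
by rewrite lee_fin lez_nat; apply: min_a; apply/asboolP; exists x.
Qed.

Lemma p_ordering_exists p S : S !=set0 -> exists a, p_ordering p S a.
Proof.
move=> S0.
(* The next term depends on all earlier ones, so it is chosen as a function of the list of them. *)
have /choice[next nextP] (s : seq int) : exists a, S a /\ forall x, S x ->
    (padic_val p (\prod_(y <- s) (a - y)%R)
       <= padic_val p (\prod_(y <- s) (x - y)%R))%E.
  have [a Sa aP] := padic_val_min p (fun x => \prod_(y <- s) (x - y)) S0.
  by exists a.
pose hist := fix hist n := if n is m.+1 then rcons (hist m) (next (hist m)) else [::].
pose a n := next (hist n).
have histE n x : \prod_(y <- hist n) (x - y) = \prod_(i < n) (x - a i).
  elim: n => [|n IHn]; first by rewrite big_nil big_ord0.
  by rewrite /= big_rcons big_ord_recr /= IHn /a mulrC.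
exists a; split=> [n|n _ x Sx]; first by case: (nextP (hist n)).
by rewrite -!histE; apply: (nextP (hist n)).2.
Qed.

(** A full p-ordering exists, so [xget] does not return its default; comparison in both directions
    identifies the value. *)
Lemma bhargava_val_upto p n S b : prime p -> p_ordering_upto p n S b ->
    \prod_(i < n) (b n - b i) != 0 ->
  bhargava_val p n S = logn p `|\prod_(i < n) (b n - b i)|.
Proof.
move=> pr_p bP b0; apply: xget_unique.
  have S0 : S !=set0 by exists (b 0%N); apply: bP.1.
  have [a aP] := p_ordering_exists p S0; exists a => //.
  apply/eqP; have aU := p_ordering_uptoW n aP.
  have -> : ((logn p `|\prod_(i < n) (b n - b i)|)%:Z)%:E
      = padic_val p (\prod_(i < n) (b n - b i)).
    by rewrite /padic_val (negbTE b0).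
  by rewrite eq_le !(p_ordering_upto_le pr_p aU bP, p_ordering_upto_le pr_p bP aU).
move=> v [a /(p_ordering_uptoW n) aU va].
have : ((v%:Z)%:E == padic_val p (\prod_(i < n) (b n - b i)))%E.
  by rewrite -va eq_le (p_ordering_upto_le pr_p aU bP) (p_ordering_upto_le pr_p bP aU).
by rewrite /padic_val (negbTE b0) => /eqP[].
Qed.

(** * Divisibility of products of consecutive integers and of symmetric products *)

Lemma dvdz_prodB (d : int) n (x y : 'I_n -> int) :
  (forall i, (d %| x i - y i)%Z) -> (d %| \prod_i x i - \prod_i y i)%Z.
Proof.
move=> dxy; apply: (big_ind2 (fun u v => (d %| u - v)%Z)) => [|u u' v v' du dv|i _].
- by rewrite subrr dvdz0.
- have -> : u * v - u' * v' = u * (v - v') + (u - u') * v' by ring.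
  by apply: rpredD; [apply: dvdz_mull | apply: dvdz_mulr].
- exact: dxy.
Qed.

Lemma ffact_prodz m n : (n <= m)%N ->
  (m ^_ n)%:Z = \prod_(i < n) (m%:Z - i%:Z).
Proof.
move=> le_nm; rewrite ffact_prod -natz natr_prod; apply: eq_bigr => i _.
by rewrite natz subzn // (leq_trans (ltnW (ltn_ord i))).
Qed.

(** For natural [t] the quotient is a binomial coefficient. In general, translating [t] by a
    multiple of [n!] makes it nonnegative and preserves the product modulo [n!]. *)
Lemma dvdz_fact_prod n (t : int) : (n`!%:Z %| \prod_(i < n) (t - i%:Z))%Z.
Proof.
have dvd_nat (m : nat) : (n`!%:Z %| \prod_(i < n) (m%:Z - i%:Z))%Z.
  case: (leqP n m) => [le_nm|lt_mn]; last first.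
    by rewrite (bigD1 (Ordinal lt_mn)) //= subrr mul0r dvdz0.
  by rewrite -ffact_prodz // -bin_ffact PoszM; apply: dvdz_mull.
pose t' := t + n`!%:Z * `|t|%N%:Z.
have t'_ge0 : 0 <= t' by have : (0 < n`!)%N := fact_gt0 n; rewrite /t'; nia.
rewrite -[X in (_ %| X)%Z](subKr (\prod_(i < n) (t' - i%:Z))).
apply: rpredB; first by rewrite -(gez0_abs t'_ge0); apply: dvd_nat.
apply: dvdz_prodB => i.
have -> : t' - i%:Z - (t - i%:Z) = n`!%:Z * `|t|%N%:Z by rewrite /t'; ring.
exact: dvdz_mulr.
Qed.

(* [sym_prod d k t] is [prod_(i < k) (F t - F i)] for [F x = x (x + d)]. *)
Definition sym_prod (d k : nat) (t : int) : int :=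
  \prod_(i < k) ((t - i%:Z) * (t + i%:Z + d%:Z)).

Lemma sym_prodS d k t :
  sym_prod d k.+1 t = sym_prod d k t * ((t - k%:Z) * (t + k%:Z + d%:Z)).
Proof. by rewrite /sym_prod big_ord_recr. Qed.

(** The factors [t - i] and [t + i + 1] together fill the interval from [t - k + 1] to [t + k]. *)
Lemma sym_prod1E k t : sym_prod 1 k t = \prod_(j < k.*2) (t + k%:Z - j%:Z).
Proof.
elim: k => [|k IHk]; first by rewrite /sym_prod !big_ord0.
rewrite sym_prodS IHk doubleS big_ord_recr big_ord_recl /=.
have -> : \prod_(i < k.*2) (t + k.+1%:Z - (bump 0 i)%:Z)
    = \prod_(i < k.*2) (t + k%:Z - i%:Z).
  by apply: eq_bigr => i _; rewrite /bump /=; lia.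
have -> : t - k%:Z = t + k.+1%:Z - (k.*2.+1)%:Z by lia.
have -> : t + k%:Z + 1%:Z = t + k.+1%:Z - 0%:Z by lia.
ring.
Qed.

(** For positive [k], the product with [d = 0] repeats the factor [t] and lacks [t + k]. *)
Lemma sym_prod_shiftr k t : t * sym_prod 1 k t = (t + k%:Z) * sym_prod 0 k t.
Proof.
elim: k => [|k IHk]; first by rewrite /sym_prod !big_ord0 addr0.
rewrite !sym_prodS [LHS]mulrA IHk -addn1 PoszD; ring.
Qed.

Lemma sym_prod_shiftl k t :
  t * sym_prod 1 k (t - 1) = (t - k%:Z) * sym_prod 0 k t.
Proof.
elim: k => [|k IHk]; first by rewrite /sym_prod !big_ord0 subr0.
rewrite !sym_prodS [LHS]mulrA IHk -addn1 PoszD; ring.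
Qed.

Lemma sym_prod1_fact k : sym_prod 1 k k = (k.*2)`!%:Z.
Proof.
by rewrite -ffactnn ffact_prodz // sym_prod1E -PoszD addnn.
Qed.

Lemma sym_prod0_fact k : (0 < k)%N -> 2 * sym_prod 0 k k = (k.*2)`!%:Z.
Proof.
move=> k_gt0; have k0 : k%:Z != 0 by lia.
apply: (mulfI k0); rewrite -sym_prod1_fact sym_prod_shiftr; ring.
Qed.

Lemma sym_prod_neq0 (d : bool) k : sym_prod d k k != 0.
Proof.
case: d; first by rewrite sym_prod1_fact; have := fact_gt0 k.*2; lia.
case: k => [|k]; first by rewrite /sym_prod big_ord0.
apply/eqP => s0; have := sym_prod0_fact (ltn0Sn k); rewrite s0 mulr0.
by have := fact_gt0 k.+1.*2; lia.
Qed.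

Lemma sym_prod_dvd (d : bool) k t : (sym_prod d k k %| sym_prod d k t)%Z.
Proof.
have dvd1 s : (sym_prod 1 k k %| sym_prod 1 k s)%Z.
  by rewrite sym_prod1_fact sym_prod1E dvdz_fact_prod.
case: d => //; case: (posnP k) => [-> |k_gt0]; first by rewrite /sym_prod !big_ord0.
have [->|t0] := eqVneq t 0.
  by rewrite [X in (_ %| X)%Z](bigD1 (Ordinal k_gt0)) //= subrr !mul0r dvdz0.
(* After multiplication by [t], the two shift identities add up through [(t + k) + (t - k) = 2 t].
   Each summand is a product of [2 k] consecutive integers. *)
have sum_t : 2 * sym_prod 0 k t = sym_prod 1 k t + sym_prod 1 k (t - 1).
  apply: (mulfI t0); rewrite mulrDr sym_prod_shiftr sym_prod_shiftl; ring.
rewrite -(@dvdz_mul2l 2) // sum_t sym_prod0_fact // -sym_prod1_fact.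
exact: rpredD.
Qed.

(** * Local computation for quadratic polynomials *)

Lemma logn_congr p M (x u G : int) : prime p -> ~~ (p%:Z %| u)%Z -> G != 0 ->
    (logn p `|G| < M)%N -> ((p ^ M)%N%:Z %| x - u * G)%Z ->
  x != 0 /\ logn p `|x| = logn p `|G|.
Proof.
move=> pr_p pu G0 ltM dvd_xG.
have dvdM e : (e <= M)%N -> ((p ^ e)%N%:Z %| x - u * G)%Z.
  by move=> leM; apply: dvdz_trans dvd_xG; rewrite dvdzE !absz_nat dvdn_exp2l.
have dvd_le : ((p ^ logn p `|G|)%N%:Z %| x)%Z.
  rewrite -(subrK (u * G) x); apply: rpredD; first exact: dvdM (ltnW ltM).
  by apply: dvdz_mull; rewrite dvdz_pfactor.
have ndvd : ~~ ((p ^ (logn p `|G|).+1)%N%:Z %| x)%Z.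
  apply/negP => dvd_x.
  have : ((p ^ (logn p `|G|).+1)%N%:Z %| u * G)%Z.
    by rewrite -(subKr x (u * G)); apply: rpredB; [|apply: dvdM].
  rewrite Gauss_dvdzr; first by rewrite dvdz_pfactor // ltnn.
  by rewrite coprimezE absz_nat coprimeXl // prime_coprime // -dvdzE.
have x0 : x != 0 by apply: contraNneq ndvd => ->; rewrite dvdz0.
split=> //; apply/eqP; rewrite eqn_leq.
by move: ndvd dvd_le; rewrite !dvdz_pfactor // -ltnNge ltnS => -> ->.
Qed.

(** Since [M] exceeds every valuation of [G k k], the congruences transfer the minimality of [G k]
    at [t = k] to the sequence [F m], [F (m + 1)], and so on. The unit [u] may vary with [t]. *)
Lemma bhargava_val_model p (F : int -> int) (m : int) (n M : nat)
    (G : nat -> int -> int) : prime p ->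
    (forall k, (k <= n)%N -> G k k != 0) ->
    (forall k, (k <= n)%N -> (logn p `|G k k| < M)%N) ->
    (forall k t, (k <= n)%N -> (G k k %| G k t)%Z) ->
    (forall k t, (k <= n)%N -> exists2 u, ~~ (p%:Z %| u)%Z &
       ((p ^ M)%N%:Z %| \prod_(i < k) (F (m + t) - F (m + i%:Z)) - u * G k t)%Z) ->
  bhargava_val p n (range F) = logn p `|G n n|.
Proof.
move=> pr_p G0 GM Gdvd FG; pose b k := F (m + k%:Z).
have bG k : (k <= n)%N -> \prod_(i < k) (b k - b i) != 0 /\
    logn p `|\prod_(i < k) (b k - b i)| = logn p `|G k k|.
  move=> lekn; have [u pu dvdu] := FG k k lekn.
  exact: logn_congr (G0 k lekn) (GM k lekn) dvdu.
have [bn0 <-] := bG n (leqnn n); apply: bhargava_val_upto => //.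
split=> [k _|k lekn _ [x _ <-]]; first by exists (m + k%:Z).
have [bk0 bk] := bG k lekn; rewrite {1}/padic_val (negbTE bk0) bk -padic_val_dvd //.
have [u _ dvdu] := FG k (x - m) lekn.
rewrite (_ : m + (x - m) = x) in dvdu; last by rewrite addrC subrK.
rewrite -(subrK (u * G k (x - m)) (\prod__ _)); apply: rpredD.
  by apply: dvdz_trans dvdu; rewrite dvdzE !absz_nat dvdn_exp2l // ltnW // GM.
apply: dvdz_mull; apply: dvdz_trans (Gdvd _ _ lekn).
by rewrite dvdz_pfactor // G0.
Qed.

Lemma bhargava_val_quad_dvd p (g a2 a1 a0 : int) n : prime p -> 0 < g ->
    gcdz a1 a2 = 1 -> (p%:Z %| a2)%Z ->
  bhargava_val p n (range (fun x => g * (a2 * x ^+ 2 + a1 * x) + a0))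
    = (n * logn p `|g| + logn p n`!)%N.
Proof.
move=> pr_p g_gt0 a12 pa2.
pose G k (t : int) := g ^+ k * \prod_(i < k) (t - i%:Z).
have Gkk k : G k k = (`|g| ^ k * k`!)%N%:Z.
  by rewrite /G -ffact_prodz // ffactnn PoszM -abszX gez0_abs // exprn_ge0 // ltW.
have nz k : (0 < `|g| ^ k * k`!)%N by rewrite muln_gt0 expn_gt0 absz_gt0 gt_eqF ?fact_gt0.
pose M := (\sum_(k < n.+1) logn p `|G k k|).+1.
rewrite (@bhargava_val_model p _ 0 n M G) //.
- by rewrite Gkk absz_nat lognM ?lognX ?fact_gt0 ?expn_gt0 ?absz_gt0 ?(gt_eqF g_gt0).
- by move=> k _; rewrite Gkk eqz_nat -lt0n.
- move=> k; rewrite -ltnS => lekn.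
  by rewrite /M (bigD1 (Ordinal lekn)) //= ltnS leq_addr.
- move=> k t _; rewrite Gkk [X in (_ %| X)%Z]/G PoszM -abszX gez0_abs ?exprn_ge0 ?ltW //.
  by rewrite dvdz_mul2l ?expf_neq0 ?gt_eqF ?dvdz_fact_prod.
(* Here the congruence is an equality; each cofactor is a unit at [p] because [p] divides [a2] and
   hence not [a1]. *)
move=> k t _; exists (\prod_(i < k) (a2 * (t + i%:Z) + a1)).
  have pa1 : ~~ (p%:Z %| a1)%Z.
    apply/negP => pa1; have : (p%:Z %| gcdz a1 a2)%Z by rewrite dvdz_gcd pa1.
    by rewrite a12 dvdzE absz_nat dvdn1 => /eqP p1; rewrite p1 in pr_p.
  apply: (big_ind (fun u => ~~ (p%:Z %| u)%Z)) => [|u v pu pv|i _].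
  - by rewrite dvdzE absz_nat dvdn1; apply: contraTneq pr_p => ->.
  - by rewrite dvdzE abszM Euclid_dvdM // negb_or -!dvdzE pu pv.
  - by rewrite rpredDl // dvdz_mulr.
have -> : \prod_(i < k) (a2 * (t + i%:Z) + a1) * G k t
    = \prod_(i < k) ((a2 * (t + i%:Z) + a1) * (g * (t - i%:Z))).
  by rewrite /G !big_split /= prodr_const card_ord.
by apply: dvdz_prodB => i; rewrite [X in (_ %| X)%Z](_ : _ = 0) ?dvdz0 //; ring.
Qed.

Lemma bhargava_val_quad_ndvd p (g a2 a1 a0 : int) n : prime p -> 0 < g ->
    ~~ (p%:Z %| a2)%Z ->
  bhargava_val p n (range (fun x => g * (a2 * x ^+ 2 + a1 * x) + a0))
    = (n * logn p `|g|
       + logn p `|sym_prod (~~ ((p == 2) && (2 %| a1)%Z)) n n|)%N.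
Proof.
(* [d] is the parity imposed on [c]: odd, except when [p = 2] and [a1] is even. *)
move=> pr_p g_gt0 pa2; set d := ~~ _.
pose G k (t : int) := g ^+ k * sym_prod d k t.
have Gkk k : G k k != 0 by rewrite mulf_neq0 ?sym_prod_neq0 ?expf_neq0 ?gt_eqF.
pose M := (\sum_(k < n.+1) logn p `|G k k|).+1.
(* Modulo [p ^ M], the quadratic is symmetric about [m - d / 2]. *)
have [m dvd_m] : exists m, ((p ^ M)%N%:Z %| a2 * (m *+ 2 - d%:Z) + a1)%Z.
  have co_a2 : coprimez a2 (p ^ M)%N%:Z.
    by rewrite coprimezE absz_nat coprimeXr // coprime_sym prime_coprime // -dvdzE.
  have [[u v] /= uv] := coprimezP _ _ co_a2.
  (* By Bezout [u] inverts [a2] modulo [p ^ M], so [c0] represents [a1 / a2]; only its parity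
     remains to be adjusted. *)
  pose c0 := u * a1.
  have dvd_c0 : ((p ^ M)%N%:Z %| a1 - a2 * c0)%Z.
    have -> : a1 - a2 * c0 = v * a1 * (p ^ M)%N%:Z.
      by rewrite /c0 -[X in X - _]mul1r -uv; ring.
    exact: dvdz_mull.
  have [c [dvd_c [m cE]]] : exists c, ((p ^ M)%N%:Z %| a1 - a2 * c)%Z /\
      exists m, c = d%:Z - m *+ 2.
    have odd_half c : ~~ (2 %| c)%Z -> exists m, c = 1 - m *+ 2.
      by move=> c_odd; exists (- (c %/ 2)%Z); lia.
    rewrite /d; have [p2|p2] := eqVneq p 2%N => /=; last first.
      have [c0_odd|c0_even] := boolP (~~ (2 %| c0)%Z).
        by exists c0; split=> //; apply: odd_half.
      (* For odd [p], adding the odd number [p ^ M] switches the parity and keeps the residue. *)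
      exists (c0 + (p ^ M)%N%:Z); split.
        have -> : a1 - a2 * (c0 + (p ^ M)%N%:Z)
            = a1 - a2 * c0 - a2 * (p ^ M)%N%:Z by ring.
        by rewrite rpredB ?dvdz_mull.
      apply: odd_half; have : odd (p ^ M).
        by case: (even_prime pr_p) => [/eqP|]; [rewrite (negbTE p2) | rewrite oddX orbC => ->].
      by move: c0_even; lia.
    exists c0; split=> //.
    (* For [p = 2], [M] is positive and [a2] is odd, so [c0] has the parity of [a1]. *)
    have dvd2_c0 : (2 %| a1 - a2 * c0)%Z.
      by apply: dvdz_trans dvd_c0; rewrite p2 dvdzE !absz_nat dvdn_exp.
    have [a1_even|a1_odd] := boolP (2 %| a1)%Z => /=; last first.
      apply: odd_half; apply: contra a1_odd => c0_even.
      rewrite -(subrK (a2 * c0) a1); apply: rpredD => //; exact: dvdz_mull.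
    have : (2 %| a2 * c0)%Z by rewrite -(subKr a1 (a2 * c0)) rpredB.
    rewrite Gauss_dvdzr; first by move=> c0_even; exists (- (c0 %/ 2)%Z); lia.
    by rewrite coprimezE prime_coprime // -dvdzE; move: pa2; rewrite p2.
  exists m; move: dvd_c; rewrite cE; set X := (X in (_ %| X)%Z -> _).
  by have -> : X = a2 * (m *+ 2 - d%:Z) + a1 by rewrite /X; ring.
rewrite (@bhargava_val_model p _ m n M G) //.
- by rewrite abszM abszX lognM ?lognX ?expn_gt0 ?absz_gt0 ?sym_prod_neq0 ?(gt_eqF g_gt0).
- move=> k; rewrite -ltnS => lekn.
  by rewrite /M (bigD1 (Ordinal lekn)) //= ltnS leq_addr.
- by move=> k t _; rewrite dvdz_mul2l ?expf_neq0 ?gt_eqF ?sym_prod_dvd.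
(* Each difference is [g (t - i) (a2 (t + i + d) + (a2 (2 m - d) + a1))], and the last bracket
   vanishes modulo [p ^ M]. *)
move=> k t _; exists (a2 ^+ k).
  by rewrite dvdzE abszX Euclid_dvdX // negb_and -dvdzE pa2.
have -> : a2 ^+ k * G k t
    = \prod_(i < k) (a2 * (g * ((t - i%:Z) * (t + i%:Z + d%:Z)))).
  by rewrite /G /sym_prod !big_split /= !prodr_const card_ord.
apply: dvdz_prodB => i; set X := (X in (_ %| X)%Z).
have -> : X = g * (t - i%:Z) * (a2 * (m *+ 2 - d%:Z) + a1) by rewrite /X; ring.
exact: dvdz_mull.
Qed.

(** * From local valuations to the product over all primes *)

Lemma fsbig_nat_bounded (R : Type) (idx : R) (op : Monoid.com_law idx)
    (A : set nat) (F : nat -> R) B :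
  (forall i, A i -> (B <= i)%N -> F i = idx) ->
  \big[op/idx]_(i \in A) F i = \big[op/idx]_(0 <= i < B | i \in A) F i.
Proof.
move=> F1; rewrite fsbig_mkcond.
rewrite -(fsbig_widen [set` index_iota 0 B] setT) //; last first.
  move=> i [_ /=]; rewrite mem_index_iota /= => /negP; rewrite -leqNgt /patch => leBi.
  by case: ifPn => // /set_mem Ai; apply: F1.
by rewrite -fsbig_seq ?iota_uniq // [RHS]big_mkcond; apply: eq_bigr.
Qed.

Lemma legendre_sumE p l : prime p -> legendre_sum p l = logn p l`!.
Proof.
move=> pr_p; rewrite logn_fact // /legendre_sum (@fsbig_nat_bounded _ _ _ _ _ l.+1).
  rewrite big_mkcond big_ltn //= memNset // add0n; apply: eq_big_nat => k /andP[k1 _].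
  by rewrite mem_set.
move=> k _ lt_lk; rewrite divn_small // (leq_trans lt_lk) // ltnW // ltn_expl //.
exact: prime_gt1.
Qed.

Lemma logn_fact_large p n : (n < p)%N -> logn p n`! = 0%N.
Proof.
move=> lt_np; have [pr_p|npr_p] := boolP (prime p); last by rewrite lognE (negbTE npr_p).
rewrite logn_fact // big1_seq // => k /andP[_]; rewrite mem_index_iota => /andP[k_gt0 _].
rewrite divn_small // (leq_trans lt_np) // -[X in (X <= _)%N]expn1.
by rewrite leq_exp2l // prime_gt1.
Qed.

Lemma logn_large p n : (n < p)%N -> logn p n = 0%N.
Proof.
case: (posnP n) => [->|n_gt0 lt_np]; first by rewrite logn0.
by apply/eqP; rewrite -leqn0 leqNgt logn_gt0 mem_primes n_gt0 /=;
  apply/negP => /andP[_ /(dvdn_leq n_gt0)]; rewrite leqNgt lt_np.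
Qed.

(** When [d] is false the product is half of [(2 l)!], which costs exactly one at [p = 2]. *)
Lemma sym_prod_logn p (d : bool) l : prime p -> (0 < l)%N -> (p == 2%N) || d ->
  (logn p `|sym_prod d l l| + ~~ d)%N = logn p (2 * l)`!.
Proof.
move=> pr_p l_gt0; case: d => [_|]; first by rewrite addn0 sym_prod1_fact mul2n.
rewrite orbF => /eqP ->.
rewrite mul2n -[(l.*2)`!]absz_nat -(sym_prod0_fact l_gt0) abszM lognM ?absz_gt0 //.
  by rewrite addnC.
exact: (sym_prod_neq0 false).
Qed.

(** The correction at 2 is added on the left so that no truncated subtraction occurs. *)
Lemma bhargava_val_quad p (g a2 a1 a0 : int) l : prime p -> 0 < g ->
    gcdz a1 a2 = 1 -> (0 < l)%N ->
  (bhargava_val p l (range (fun x => g * (a2 * x ^+ 2 + a1 * x) + a0)%R)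
     + ((p == 2%N) && ((2 %| a1)%Z && ~~ (2 %| a2)%Z)))%N
  = (l * logn p `|g|
     + (if (p%:Z %| a2)%Z then logn p l`! else logn p (2 * l)`!))%N.
Proof.
move=> pr_p g_gt0 a12 l_gt0; have [pa2|pa2] := boolP (p%:Z %| a2)%Z.
  rewrite bhargava_val_quad_dvd // -[RHS]addn0; apply/eqP; rewrite eqn_add2l eqb0.
  by apply/and3P => -[/eqP p2 _]; move: pa2; rewrite p2 => ->.
rewrite bhargava_val_quad_ndvd // -addnA; congr (_ + _)%N.
rewrite -(@sym_prod_logn p (~~ ((p == 2%N) && (2 %| a1)%Z))) //.
  2: by case: (p == 2%N).
congr (_ + _)%N; rewrite negbK.
by case: eqP => [p2|_] //=; move: pa2; rewrite p2 => ->; rewrite andbT.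
Qed.

Theorem theorem4p3 (g a2 a1 a0 : int) (f : {poly int})
    (hf : f = g *: (a2 *: 'X^2 + a1 *: 'X) + a0%:P)
    (hg : 1 <= g) (ha : gcdz a1 a2 = 1)
    (l : nat) (hl : (0 < l)%N) :
  (bhargava_fact l (range (fun x : int => f.[x])))%:R
  = g%:~R ^+ l
    * (\big[muln/1%N]_(p \in [set p : nat | prime p /\ (p%:Z %| a2)%Z])
         (p ^ legendre_sum p l)%N)%:R
    * (\big[muln/1%N]_(p \in [set p : nat | prime p /\ ~ (p%:Z %| a2)%Z])
         (p ^ legendre_sum p (2 * l))%N)%:R
    * 2%:R ^- ((2 %| a1)%Z && ~~ (2 %| a2)%Z) :> rat.
Proof.
have g_gt0 : 0 < g by lia.
have -> : (fun x => f.[x]) = (fun x => g * (a2 * x ^+ 2 + a1 * x) + a0).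
  by apply/funext => x; rewrite hf !hornerE.
set F := fun x : int => _; set delta := _ && _.
(* A prime from [B] on exceeds [g], [2 l] and 2, so it contributes 1 to every product; 2 itself lies
   below [B]. *)
pose B := (`|g| + 2 * l + 3)%N.
have val_p p : prime p -> (bhargava_val p l (range F) + (p == 2) && delta)%N
  = (l * logn p `|g|
     + (if (p%:Z %| a2)%Z then logn p l`! else logn p (2 * l)`!))%N.
  by move=> pr_p; apply: bhargava_val_quad.
rewrite /bhargava_fact (@fsbig_nat_bounded _ _ _ _ _ B); last first.
  move=> p /val_p val_pE leBp; have := val_pE.
  have -> : (p == 2%N) = false by apply/eqP; lia.
  rewrite /= addn0 => ->; rewrite (@logn_large _ `|g|) ?muln0; last by lia.
  by rewrite !logn_fact_large ?if_same //; lia.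
rewrite !(@fsbig_nat_bounded _ _ _ _ _ B); last 2 first.
- move=> p [pr_p _] leBp; rewrite legendre_sumE // logn_fact_large //; lia.
- move=> p [pr_p _] leBp; rewrite legendre_sumE // logn_fact_large //; lia.
rewrite [X in X%:R](@big_mkcond) [X in _ * X%:R](@big_mkcond).
rewrite [X in _ ^+ l * X%:R](@big_mkcond).
have gE : (`|g| ^ l = \prod_(0 <= p < B) p ^ (l * logn p `|g|))%N.
  rewrite -{1}(@partnT `|g|) ?absz_gt0 ?gt_eqF // (@widen_partn B.-1); last by rewrite /B; lia.
  have -> : B.-1.+1 = B by rewrite /B; lia.
  rewrite (big_morph (fun n => n ^ l)%N (fun x y => expnMn x y l) (exp1n l)).
  by apply: eq_bigr => p _; rewrite mulnC expnM.
have dE : (2 ^ delta = \prod_(0 <= p < B) 2 ^ ((p == 2) && delta))%N.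
  rewrite (bigD1_seq 2%N) ?iota_uniq ?mem_index_iota //=; last by rewrite /B; lia.
  by rewrite big1 ?muln1 // => p /negbTE ->.
set N := \big[_/_]_(_ <- _) _; set P1 := \big[_/_]_(_ <- _) _.
set P2 := \big[_/_]_(_ <- _) _.
(* Clearing the denominator leaves an identity of naturals, checked one index [p] at a time. *)
suff main : (N * 2 ^ delta = `|g| ^ l * P1 * P2)%N.
  apply: (canRL (mulfK _)); first by rewrite expf_neq0.
  have -> : g%:~R = `|g|%:R :> rat by rewrite -[in LHS](gtz0_abs g_gt0).
  by rewrite -!natrX -!natrM main.
rewrite dE gE /N /P1 /P2 -!big_split /=; apply: eq_bigr => p _.
have [pr_p|npr_p] := boolP (prime p); last first.
  rewrite !memNset /=; first last.
  - by rewrite (negbTE npr_p).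
  - by rewrite (negbTE npr_p) => -[].
  - by rewrite (negbTE npr_p) => -[].
  have -> : (p == 2%N) = false by apply: contraNF npr_p => /eqP ->.
  by rewrite lognE (negbTE npr_p) muln0.
rewrite mem_set //=.
have -> : (2 ^ ((p == 2) && delta) = p ^ ((p == 2) && delta))%N by case: eqP => [->|].
rewrite -expnD val_p // expnD -mulnA; congr (_ * _)%N.
have [pa2|pa2] := boolP (p%:Z %| a2)%Z.
  by rewrite mem_set //= memNset /= ?muln1 ?legendre_sumE // => -[].
rewrite memNset /=; last by case=> _; apply/negP.
by rewrite mul1n mem_set ?legendre_sumE //=; split=> //; apply/negP.
Qed.
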